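(* Let $\nu>0$ and let $F\in V'$ with $F\ge0$. Suppose that: (i) the sequence $\{f_n\}$ in $L^\infty_\nu(\Omega)$, with $0\le f_n\le F$ for all $n\in\mathbb{N}$, is non-decreasing and $\lim_{n\to\infty}f_n=f^*$ in $L^\infty(\Omega)$ for some $f^*$; (ii) the increasing map $\Phi:H^+\to H^+$ satisfies $$\lambda\Phi(y)\le\Phi(\lambda y)\quad\text{for all }0<\lambda<1,\ y\in H^+,$$ and Assumption (A) (stated in the context). Then $$\mathbf{M}(f_n)\uparrow\mathbf{M}(f^* )\ \text{in } H,\quad\text{and}\quad\mathbf{M}(f_n)\to\mathbf{M}(f^* )\ \text{in } V.$$
   Context: $(V,H,V')$ is a Gelfand triple of Hilbert spaces: $V\hookrightarrow H\hookrightarrow V'$ with dense and continuous embeddings, $H$ identified with $H'$; $\langle\cdot,\cdot\rangle$ is the duality pairing of $V'$ and $V$, $(\cdot,\cdot)$ the inner product of $H$. $H^+\subset H$ is a closed convex cone with $H^+=\{v\in H:(v,y)\ge0\ \forall y\in H^+\}$, and $x\le y$ means $y-x\in H^+$. For $x\in H$, $x^+$ is the orthogonal projection of $x$ onto $H^+$ and $x^-:=x^+-x$; $\sup(x,y):=x+(y-x)^+$, $\inf(x,y):=x-(x-y)^+$. It is assumed that $y\in V$ implies $y^+\in V$, and $\|y^+\|_V\le M\|y\|_V$ for all $y\in V$ and some $M>0$. $V$ and $H$ are spaces of functions $h:\Omega\to\mathbb{R}$ on an open set $\Omega\subset\mathbb{R}^N$, with $L^\infty(\Omega)\hookrightarrow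 H$ densely and continuously, and $L^\infty(\Omega)$ inherits the order of $H$ (prototype: $V=H_0^1(\Omega)$, $H=L^2(\Omega)$, $H^+$ the a.e. non-negative functions). In $V'$, $f_1\le f_2$ means $\langle f_2-f_1,v\rangle\ge0$ for all $v\in V$ with $v\ge0$. $L^\infty_\nu(\Omega):=\{z\in L^\infty(\Omega): z(x)\ge\nu \text{ for a.a. } x\in\Omega\}$. For $x\le y$ in $H$, $[x,y]:=\{z\in H:x\le z\le y\}$. $z_n\uparrow z$ in $H$ means $z_n\le z_{n+1}$ for all $n$ and $z_n\to z$ in $H$. $A:V\to V'$ (possibly nonlinear) is: homogeneous of order one ($A(tu)=tA(u)$ for $u\in V$, $t>0$); Lipschitz continuous ($\|A(u)-A(v)\|_{V'}\le C\|u-v\|_V$); strongly monotone ($\langle A(u)-A(v),u-v\rangle\ge c\|u-v\|_V^2$ for some $c>0$); and T-monotone ($\langle A(u)-A(v),(u-v)^+\rangle\ge0$ for all $u,v\in V$, with equality if and only if $(u-v)^+=0$). $\Phi:H^+\to H^+$ is increasing ($0\le v\le w$ implies $\Phi(v)\le\Phi(w)$), extended to $H$ by $x\mapsto\Phi(x^+)$ when needed. For $\psi\in H^+$, $\mathbf{K}(\psi):=\{v\in V:v\le\psi\}$; for $f\in V'$, $S(f,\psi)$ is the unique $y\in\mathbf{K}(\psi)$ with $\langle A(y)-f,v-y\rangle\ge0$ for all $v\in\mathbf{K}(\psi)$. Let $\overline{y}\in V$ be the unique solution of $A(\overline{y})=F$. For $f\in V'$ with $0\le f\le F$, the set of fixed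 points of $y\mapsto S(f,\Phi(y))$ in $[0,\overline{y}]$ is non-empty and has a largest element, denoted $\mathbf{M}(f)$. Assumption (A): $\Phi$ satisfies one of the following. (a) Whenever $v_n\rightharpoonup v$ in $V$, either $\Phi(v_n)\to\Phi(v)$ in $L^\infty_\nu(\Omega)$ (i.e. these elements lie in $L^\infty_\nu(\Omega)$ and converge in $L^\infty(\Omega)$), or $\Phi(v_n)\to\Phi(v)$ in $V$. (b) Whenever $v_n\rightharpoonup v$ in $V$, $\Phi(v_n)\to\Phi(v)$ in $H$; and there is a strongly monotone $\mathcal{Q}\in\mathscr{L}(V,V')$ (bounded linear) with $\langle\mathcal{Q}v^-,v^+\rangle\le0$ for all $v\in V$ such that for every $v\in V\cap H^+$ one has $\Phi(v)\in V$ and $\mathcal{Q}\Phi(v)\ge0$ in $V'$.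
   Formalization: The formal theorem additionally assumes that sup(x,y)=x+(y-x)^+ really is the least upper bound of x and y in H (H is a vector lattice); this does not follow from self-duality of H^+, and without it monotonicity of M(f_n) can fail. *)

(* Defs.v *)
From HB Require Import structures.
From mathcomp Require Import all_boot all_order all_algebra.
From mathcomp Require Import all_classical all_reals all_analysis.
From mathcomp Require Import lra.

Set Implicit Arguments.
Unset Strict Implicit.
Unset Printing Implicit Defensive.

Import Order.TTheory GRing.Theory Num.Theory.
Import numFieldNormedType.Exports.

Local Open Scope classical_set_scope.
Local Open Scope ring_scope.

HB.mixin Record isHilbert (R : realType) V & CompleteNormedModule R V := {
  inner : V -> V -> R ;
  innerC : forall x y, inner x y = inner y x ;
  inner_linear : forall (a : R) x y z,
    inner (a *: x + y) z = a * inner x z + inner y z ;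
  inner_norm : forall x, inner x x = `|x| ^+ 2
}.

#[short(type="hilbertType")]
HB.structure Definition Hilbert (R : realType) :=
  {V of isHilbert R V & CompleteNormedModule R V}.

Lemma cauchy_schwarz (R : realType) (H : hilbertType R) (x y : H) :
  `|inner x y| <= `|x| * `|y|.
Proof.
have innerr (a : R) (u v w : H) : inner w (a *: u + v) = a * inner w u + inner w v :> R.
  by rewrite innerC inner_linear !(innerC _ w).
have [->|y0] := eqVneq y 0.
  have -> : inner x (0 : H) = 0 :> R.
    by have := innerr 1 0 0 x; rewrite scaler0 addr0 mul1r => /eqP;
      rewrite -subr_eq subrr => /eqP <-.
  by rewrite !normr0 mulr0.
have yy : 0 < `|y| ^+ 2 by rewrite exprn_gt0// normr_gt0.
rewrite -(@ler_pXn2r _ 2)// ?nnegrE ?mulr_ge0//.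
rewrite real_normK ?num_real// exprMn.
set t := inner x y / `|y| ^+ 2.
have : 0 <= inner (- t *: y + x) (- t *: y + x) by rewrite inner_norm sqr_ge0.
rewrite inner_linear !innerr !inner_norm (innerC y x).
have <- : t * `|y| ^+ 2 = inner x y by rewrite divfK// gt_eqF.
set Y := `|y| ^+ 2 in yy *; set X := `|x| ^+ 2 => h.
by rewrite exprMn expr2 (expr2 Y) mulrA ler_pM2r//; lra.
Qed.

Section Dual.
Context (R : realType) (V : normedModType R).

Definition dual_pred : {pred V -> R^o} :=
  mem [set f : V -> R^o | linear f /\ continuous f].

Lemma dual_submod_closed : submod_closed dual_pred.
Proof.
split=> [|a f g].
  rewrite inE /=; split=> [c x y|]; first by rewrite scaler0 addr0.
  exact: cst_continuous.
rewrite !inE /= => -[lf cf] [lg cg]; split=> [c x y|x].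
  change (a *: f (c *: x + y) + g (c *: x + y) =
          c *: (a *: f x + g x) + (a *: f y + g y)).
  rewrite lf lg !scalerDr !scalerA (mulrC a c) -!addrA; congr (_ + _).
  by rewrite addrCA.
apply: (@continuousD R R^o V (fun y => a *: f y) g x); last exact: cg.
apply: (@continuousZ R R^o V (fun=> a) f x); last exact: cf.
exact: cst_continuous.
Qed.

HB.instance Definition _ :=
  GRing.isSubmodClosed.Build R (V -> R^o) dual_pred dual_submod_closed.

Record dual := Dual { dual_val :> V -> R^o ; dual_valP : dual_val \in dual_pred }.

HB.instance Definition _ := [isSub for dual_val].
HB.instance Definition _ := [Choice of dual by <:].
HB.instance Definition _ := [SubChoice_isSubLmodule of dual by <:].

Definition dual_norm (f : dual) : R :=
  sup [set `|f v| | v in [set v | `|v| <= 1]].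

End Dual.
Arguments dual {R} V.

Definition weak_cvg (R : realType) (V : normedModType R) (u : nat -> V)
    (l : V) : Prop :=
  forall g : dual V, (fun n => g (u n)) @ \oo --> g l.

Section Gelfand.
Context (R : realType) (V H : hilbertType R).

Record gelfand := Gelfand {
  gemb :> {linear V -> H} ;
  gemb_continuous : continuous gemb ;
  gemb_inj : injective gemb ;
  gemb_dense : dense (range gemb)
}.

Lemma pivot_subproof (j : gelfand) (h : H) :
  (fun v : V => inner h (j v) : R^o) \in @dual_pred R V.
Proof.
have lin_ip : linear (fun x : H => inner h x : R^o).
  by move=> a x y; rewrite innerC inner_linear !(innerC _ h).
pose L := GRing.isLinear.Build R H R^o *:%R _ lin_ip.
pose ip : {linear H -> R^o} := HB.pack (fun x : H => inner h x : R^o) L.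
have cip : continuous ip.
  apply/bounded_linear_continuous/linear_boundedP; near=> r => x.
  apply: le_trans (cauchy_schwarz h x) _.
  by rewrite ler_wpM2r//; near: r; exact: nbhs_pinfty_ge.
rewrite inE /=; split=> [a x y|x].
  by rewrite linearP; exact: lin_ip.
exact: (continuous_comp (@gemb_continuous j x) (cip (j x))).
Unshelve. all: by end_near. Qed.

(* The embedding of H, identified with its dual, into the dual of V. *)
Definition pivot (j : gelfand) (h : H) : dual V := Dual (pivot_subproof j h).

End Gelfand.

(* The ambient dimension is N.+1 >= 1. *)
Section LebesgueMeasure.
Context (R : realType) (N : nat).
Local Notation RN := 'rV[R]_N.+1.

Definition box (ab : RN * RN) : set RN :=
  [set x | forall i, x 0 i \in `[ab.1 0 i, ab.2 0 i]].

Definition box_vol (ab : RN * RN) : \bar R :=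
  (\prod_i Num.max 0 (ab.2 0 i - ab.1 0 i))%:E.

Lemma box_vol_ge0 ab : (0 <= box_vol ab)%E.
Proof. by rewrite lee_fin prodr_ge0// => i _; rewrite le_max lexx. Qed.

Definition lebesgue_outer (E : set RN) : \bar R :=
  ereal_inf [set (\sum_(k <oo) box_vol (B k))%E |
             B in [set B : nat -> RN * RN | E `<=` \bigcup_k box (B k)]].

(* Lebesgue outer measure of the trace on Omega; for open Omega, the
   Caratheodory-measurable sets of this outer measure are the E such that
   E `&` Omega is Lebesgue measurable, and the complement of Omega is null. *)
Definition lebesgue_outer_on (Omega E : set RN) : \bar R :=
  lebesgue_outer (E `&` Omega).

Lemma lebesgue_outer_ge0 E : (0 <= lebesgue_outer E)%E.
Proof.
apply: le_ereal_inf_tmp => _ [B _ <-].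
by apply: nneseries_ge0 => n _ _; exact: box_vol_ge0.
Qed.

Lemma le_lebesgue_outer A B :
  A `<=` B -> (lebesgue_outer A <= lebesgue_outer B)%E.
Proof.
move=> AB; apply/ereal_inf_le_tmp => _ [C BC <-].
by exists C => //; apply: subset_trans BC.
Qed.

Lemma lebesgue_outer0 : lebesgue_outer set0 = 0%E.
Proof.
apply/eqP; rewrite eq_le lebesgue_outer_ge0 andbT.
apply: ereal_inf_lbound; exists (fun=> (0, 0)) => //.
rewrite eseries0// => i _ _; congr EFin.
by rewrite big_ord_recl/= !mxE subrr maxxx mul0r.
Qed.

Lemma lebesgue_outer_sigma_subadditive : sigma_subadditive lebesgue_outer.
Proof.
move=> A; have [[i ioo]|] := pselect (exists i, lebesgue_outer (A i) = +oo%E).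
  rewrite (eseries_pinfty _ _ ioo) ?leey// => n _.
  by rewrite -ltNye (lt_le_trans _ (lebesgue_outer_ge0 _)).
rewrite -forallNE => Aoo.
suff add2e (e : {posnum R}) : (lebesgue_outer (\bigcup_n A n) <=
    \sum_(i <oo) lebesgue_outer (A i) + e%:num%:E)%E.
  by apply/lee_addgt0Pr => _/posnumP[].
rewrite (le_trans _ (epsilon_trick _ _ _))//; last first.
  by move=> n; exact: lebesgue_outer_ge0.
pose P n (B : nat -> RN * RN) := A n `<=` \bigcup_k box (B k) /\
  (\sum_(k <oo) box_vol (B k) <=
   lebesgue_outer (A n) + (e%:num / (2 ^ n.+1)%:R)%:E)%E.
have [G PG] : {G : nat -> nat -> RN * RN & forall n, P n (G n)}.
  apply: (@choice _ _ P) => n; rewrite /P /lebesgue_outer.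
  set S := (X in ereal_inf X); move infS : (ereal_inf S) => iS.
  case: iS infS => [r Sr|Soo|Soo].
  - have en1 : (0 < e%:num / (2 ^ n.+1)%:R)%R by [].
    have /(lb_ereal_inf_adherent en1) : ereal_inf S \is a fin_num by rewrite Sr.
    move=> [x [B AnB muBx] xS].
    by exists B; split => //; rewrite muBx -Sr; exact/ltW.
  - by have := Aoo n; rewrite /lebesgue_outer Soo.
  - suff : lbound S 0%E by move/le_ereal_inf_tmp; rewrite Soo.
    move=> /= _ [B AnB <-].
    by apply: nneseries_ge0 => ? _ _; exact: box_vol_ge0.
pose vG (p : nat * nat) := box_vol (uncurry G p).
have vG_ge0 p : (0 <= vG p)%E by exact: box_vol_ge0.
apply: (@le_trans _ _ (\esum_(i in setT) vG i)).
  apply: ereal_inf_lbound => /=.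
  have /card_esym/ppcard_eqP[f] := card_nat2.
  exists (uncurry G \o f).
    move=> t [i _] /(PG i).1[j _ ?]; exists (f^-1%FUN (i, j)) => //=.
    by rewrite invK ?inE.
  rewrite -(esum_pred_image vG _ xpredT) ?[fun=> _]set_true//.
  by rewrite image_eq.
rewrite (_ : esum _ _ = \sum_(i <oo) \sum_(j <oo) vG (i, j))%E; last first.
  pose J : nat -> set (nat * nat) := fun i => [set (i, j) | j in setT].
  rewrite (_ : setT = \bigcup_k J k); last first.
    by rewrite predeqE => -[a b]; split => // _; exists a => //; exists b.
  rewrite esum_bigcupT /=; last 2 first.
    - apply/trivIsetP => i j _ _ ij.
      rewrite predeqE => -[n m] /=; split => //= -[] [_] _ [<-{n} _].
      by move=> [m' _] [] /esym/eqP; rewrite (negbTE ij).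
    - by move=> p; exact: vG_ge0.
  rewrite -(image_id [set: nat]) -fun_true esum_pred_image//; last first.
    by move=> n _; exact: esum_ge0.
  apply: eq_eseriesr => /= j _.
  rewrite -(esum_pred_image vG (pair j) predT)//=; last first.
    by move=> ? ? _ _; exact: (@can_inj _ _ _ snd).
  by congr esum; rewrite predeqE => -[a b]; split; move=> [i _ <-]; exists i.
apply: lee_nneseries => n _ //.
- by move=> _; apply: nneseries_ge0 => m *; exact: vG_ge0.
- exact: (PG n).2.
Qed.

Lemma lebesgue_outer_on0 Omega : lebesgue_outer_on Omega set0 = 0%E.
Proof. by rewrite /lebesgue_outer_on set0I lebesgue_outer0. Qed.

Lemma lebesgue_outer_on_ge0 Omega E : (0 <= lebesgue_outer_on Omega E)%E.
Proof. exact: lebesgue_outer_ge0. Qed.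

Lemma le_lebesgue_outer_on Omega :
  {homo lebesgue_outer_on Omega : A B / A `<=` B >-> (A <= B)%E}.
Proof. by move=> A B AB; apply: le_lebesgue_outer; exact: setSI. Qed.

Lemma lebesgue_outer_on_sigma_subadditive Omega :
  sigma_subadditive (lebesgue_outer_on Omega).
Proof.
by move=> F; rewrite /lebesgue_outer_on setI_bigcupl;
  exact: lebesgue_outer_sigma_subadditive.
Qed.

HB.instance Definition _ (Omega : set RN) :=
  isOuterMeasure.Build R RN (lebesgue_outer_on Omega)
    (lebesgue_outer_on0 Omega) (lebesgue_outer_on_ge0 Omega)
    (@le_lebesgue_outer_on Omega)
    (@lebesgue_outer_on_sigma_subadditive Omega).

Definition lebesgue_outer_measure (Omega : set RN) :
  {outer_measure set RN -> \bar R} := lebesgue_outer_on Omega.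

Definition lebesgue_on (Omega : set RN) :
    {measure set (caratheodory_type (lebesgue_outer_measure Omega)) -> \bar R} :=
  lebesgue_outer_measure Omega.

(* Functions rather than classes; a.e. equality is taken into account by
   [ofLinftyE] and [rep_inj] in [function_space] below. *)
Definition Linfty (Omega : set RN) := LfunType (lebesgue_on Omega) (leey 1).

Definition Linfty_norm (Omega : set RN) (z : Linfty Omega) : R :=
  fine ('N[lebesgue_on Omega]_+oo [EFin \o z])%E.

End LebesgueMeasure.

Section Order.
Context (R : realType) (H : hilbertType R) (K : set H).

Definition leK (x y : H) : Prop := K (y - x).

Definition closed_convex_cone : Prop :=
  closed K /\ forall (a b : R) x y, 0 <= a -> 0 <= b -> K x -> K y ->
    K (a *: x + b *: y).

Definition self_dual : Prop :=
  K = [set v | forall y, K y -> 0 <= inner v y].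

(* Orthogonal projection onto K, i.e. the (unique) nearest point of K. *)
Definition pos (x : H) : H :=
  xget 0 [set p | K p /\ forall q, K q -> `|x - p| <= `|x - q|].

Definition supK (x y : H) : H := x + pos (y - x).

(* [supK x y] is an upper bound of x and y for every self-dual cone, but need
   not be the least one (e.g. for the Lorentz cone in dimension 3). *)
Definition supK_lub : Prop :=
  forall x y z, leK x z -> leK y z -> leK (supK x y) z.

End Order.

Section FunctionSpace.
Context (R : realType) (N : nat) (Omega : set 'rV[R]_N.+1).

(* Elements of H are classes of functions modulo a.e. equality on Omega: [rep]
   picks a representative, and its values outside Omega are irrelevant. *)
Record function_space (H : hilbertType R) (K : set H) := FunctionSpace {
  rep : H -> 'rV[R]_N.+1 -> R ;
  rep_linear : forall (a : R) (x y : H),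
    rep (a *: x + y) = (fun t => a * rep x t + rep y t)
      %[ae lebesgue_on Omega] ;
  rep_inj : forall x, rep x = cst 0 %[ae lebesgue_on Omega] -> x = 0 ;
  ofLinfty : {linear Linfty Omega -> H} ;
  ofLinftyE : forall z, rep (ofLinfty z) = z %[ae lebesgue_on Omega] ;
  ofLinfty_bounded : exists C : R, forall z,
    `|ofLinfty z| <= C * Linfty_norm z ;
  ofLinfty_dense : dense (range ofLinfty) ;
  ofLinfty_order : forall z,
    K (ofLinfty z) <-> \forall t \ae lebesgue_on Omega, 0 <= z t
}.

Definition Linfty_ge (nu : R) (z : Linfty Omega) : Prop :=
  \forall t \ae lebesgue_on Omega, nu <= z t.

Definition Linfty_cvg (z : nat -> Linfty Omega) (l : Linfty Omega) : Prop :=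
  (fun n => Linfty_norm (z n - l)) @ \oo --> (0 : R).

End FunctionSpace.

Section Operator.
Context (R : realType) (V : normedModType R).

Definition pos_homogeneous (A : V -> dual V) : Prop :=
  forall u (t : R), 0 < t -> A (t *: u) = t *: A u.

Definition lipschitz_op (A : V -> dual V) : Prop :=
  exists C : R, forall u v, dual_norm (A u - A v) <= C * `|u - v|.

Definition strongly_monotone (A : V -> dual V) : Prop :=
  exists2 c : R, 0 < c &
    forall u v, c * `|u - v| ^+ 2 <= (A u - A v) (u - v).

Definition bounded_op (Q : {linear V -> dual V}) : Prop :=
  exists C : R, forall v, dual_norm (Q v) <= C * `|v|.

End Operator.

Section Triple.
Context (R : realType) (V H : hilbertType R) (j : gelfand V H) (K : set H).

Definition dual_le (f g : dual V) : Prop :=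
  forall v, K (j v) -> 0 <= (g - f) v.

(* The element of V representing the positive part, which is taken in H. *)
Definition posV (v : V) : V := xget 0 [set w | j w = pos K (j v)].
Definition negV (v : V) : V := posV v - v.

Definition pos_stable : Prop :=
  (forall v : V, exists w : V, j w = pos K (j v)) /\
  exists2 M : R, 0 < M & forall v : V, `|posV v| <= M * `|v|.

Definition T_monotone (A : V -> dual V) : Prop :=
  forall u v : V, 0 <= (A u - A v) (posV (u - v)) /\
    ((A u - A v) (posV (u - v)) = 0 <-> posV (u - v) = 0).

Definition obstacle_set (psi : H) : set V := [set v | leK K (j v) psi].

Definition VI_solution (A : V -> dual V) (f : dual V) (psi : H) : set V :=
  [set y | obstacle_set psi y /\
           forall v, obstacle_set psi v -> 0 <= (A y - f) (v - y)].

(* The unique solution whenever A is Lipschitz and strongly monotone and the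
   obstacle set is nonempty. *)
Definition VI_sol (A : V -> dual V) (f : dual V) (psi : H) : V :=
  xget 0 (VI_solution A f psi).

Definition increasing_map (Phi : H -> H) : Prop :=
  (forall x, K x -> K (Phi x)) /\
  forall x y, K x -> leK K x y -> leK K (Phi x) (Phi y).

(* Fixed points in the order interval [0, ybar] of H; they lie in V because
   [VI_sol] takes its values in V. *)
Definition QVI_fixed_points (A : V -> dual V) (Phi : H -> H) (ybar : V)
    (f : dual V) : set V :=
  [set y | [/\ leK K 0 (j y), leK K (j y) (j ybar) &
               VI_sol A f (Phi (j y)) = y]].

(* The largest fixed point, when there is one. *)
Definition QVI_max (A : V -> dual V) (Phi : H -> H) (ybar : V)
    (f : dual V) : V :=
  xget 0 [set y | QVI_fixed_points A Phi ybar f y /\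
    forall z, QVI_fixed_points A Phi ybar f z -> leK K (j z) (j y)].

Definition cvg_up (x : nat -> H) (l : H) : Prop :=
  (forall n, leK K (x n) (x n.+1)) /\ x @ \oo --> l.

Definition ext_map (Phi : H -> H) (x : H) : H := Phi (pos K x).

Definition assumption_A_a N (Omega : set 'rV[R]_N.+1)
    (fs : function_space Omega K) (nu : R) (Phi : H -> H) : Prop :=
  forall (v : nat -> V) (v0 : V), weak_cvg v v0 ->
    (exists (z : nat -> Linfty Omega) (z0 : Linfty Omega),
      [/\ forall n, ofLinfty fs (z n) = ext_map Phi (j (v n)),
          ofLinfty fs z0 = ext_map Phi (j v0),
          forall n, Linfty_ge nu (z n),
          Linfty_ge nu z0 &
          Linfty_cvg z z0]) \/
    (exists (w : nat -> V) (w0 : V),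
      [/\ forall n, j (w n) = ext_map Phi (j (v n)),
          j w0 = ext_map Phi (j v0) &
          w @ \oo --> w0]).

Definition assumption_A_b (Phi : H -> H) : Prop :=
  (forall (v : nat -> V) (v0 : V), weak_cvg v v0 ->
    (fun n => ext_map Phi (j (v n))) @ \oo --> ext_map Phi (j v0)) /\
  exists Q : {linear V -> dual V},
    [/\ bounded_op Q,
        strongly_monotone Q,
        forall v, Q (negV v) (posV v) <= 0 &
        forall v, K (j v) ->
          exists2 w : V, j w = Phi (j v) & dual_le 0 (Q w)].

End Triple.

(* Main.v *)
(* Comparison through T-monotonicity makes S(f, psi) increasing in f and psi
   and larger than every subsolution z of (f, psi): z <= psi and
   <A z - f, p> <= 0 for all p >= 0.  Hence the iterates of y |-> S(f, Phi y)
   started at ybar decrease; being nonnegative and bounded in V, they converge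
   strongly in H and weakly in V.  Assumption (A) passes to the limit in the
   obstacles and, since these decrease, the limit is a fixed point; it is M(f),
   and it dominates every z in [0, ybar] that is a subsolution of (f, Phi z).

   Let g be the limit of f_n and lambda_n = nu / (nu + |f_n - g|_oo), so that
   lambda_n g <= f_n.  By homogeneity of A and the scaling property of Phi,
   lambda_n M(g) is such a subsolution for f_n, whence
   lambda_n M(g) <= M(f_n) <= M(g).  Testing the variational inequality of
   M(f_n) with lambda_n M(g), and that of M(g) with M(f_n), strong monotonicity
   bounds |M(f_n) - M(g)|_V^2 by a quantity that tends to 0. *)
From HB Require Import structures.
Require Import Defs.
From mathcomp Require Import all_boot all_order all_algebra.
From mathcomp Require Import all_classical all_reals all_analysis.
From mathcomp Require Import ess_sup_inf ring lra.

Set Implicit Arguments.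
Unset Strict Implicit.
Unset Printing Implicit Defensive.

Import Order.TTheory GRing.Theory Num.Theory.
Import numFieldNormedType.Exports.

Local Open Scope classical_set_scope.
Local Open Scope ring_scope.

(** Squares appear because minimising sequences and monotone sequences in a cone have their squared
    distances bounded through the inner product. *)
Lemma cvgn_of_sqr_dist_le (R : realType) (V : completeNormedModType R)
    (u : nat -> V) (a : nat -> R) :
  a @ \oo --> (0 : R) ->
  (forall n m, (n <= m)%N -> `|u n - u m| ^+ 2 <= a n) -> cvgn u.
Proof.
move=> a0 ua; apply/cauchy_cvgP/cauchy_exP => e e0.
have e20 : 0 < e ^+ 2 by rewrite exprn_gt0.
have [N _ aN] := cvgr_lt _ a0 (e ^+ 2) e20.
exists (u N); exists N => // m /= Nm.
rewrite -ball_normE /ball_ /= -(@ltr_pXn2r _ 2)// ?nnegrE ?(ltW e0)//.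
by rewrite (le_lt_trans (ua _ _ Nm))// aN/=.
Qed.

(** * Hilbert space geometry: nearest points and Riesz representation *)

Section HilbertSpace.
Context {R : realType} {V : hilbertType R}.
Implicit Types (x y z : V) (a : R).

Lemma innerDl x y z : inner (x + y) z = inner x z + inner y z.
Proof. by rewrite -[x]scale1r inner_linear mul1r scale1r. Qed.

Lemma inner0l z : inner (0 : V) z = 0.
Proof. by apply: (addrI (inner 0 z)); rewrite -innerDl !addr0. Qed.

Lemma innerZl a x z : inner (a *: x) z = a * inner x z.
Proof. by rewrite -[a *: x]addr0 inner_linear inner0l addr0. Qed.

Lemma innerNl x z : inner (- x) z = - inner x z.
Proof. by rewrite -scaleN1r innerZl mulN1r. Qed.

Lemma innerBl x y z : inner (x - y) z = inner x z - inner y z.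
Proof. by rewrite innerDl innerNl. Qed.

Lemma innerDr x y z : inner z (x + y) = inner z x + inner z y.
Proof. by rewrite innerC innerDl !(innerC z). Qed.

Lemma innerZr a x z : inner z (a *: x) = a * inner z x.
Proof. by rewrite innerC innerZl (innerC z). Qed.

Lemma innerNr x z : inner z (- x) = - inner z x.
Proof. by rewrite innerC innerNl (innerC z). Qed.

Lemma innerBr x y z : inner z (x - y) = inner z x - inner z y.
Proof. by rewrite innerDr innerNr. Qed.

Definition innerE := (innerDl, innerDr, innerNl, innerNr, innerZl, innerZr).

Lemma inner_le x y : inner x y <= `|x| * `|y|.
Proof. exact: le_trans (ler_norm _) (cauchy_schwarz x y). Qed.

Lemma inner_dual_subproof x : (inner x : V -> R^o) \in @dual_pred R V.
Proof.
have lin : linear (inner x : V -> R^o).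
  by move=> a y z; rewrite innerDr innerZr.
rewrite inE /=; split => // y; apply/cvgrPdist_le => e e0.
near=> z; rewrite -innerBr (le_trans (cauchy_schwarz _ _))//.
have x1 : 0 < `|x| + 1 by rewrite ltr_pwDr.
rewrite (@le_trans _ _ ((`|x| + 1) * `|y - z|)) ?ler_wpM2r ?lerDl//.
rewrite -ler_pdivlMl//; near: z; apply: cvgr_dist_le => //.
by rewrite mulr_gt0// invr_gt0.
Unshelve. all: by end_near. Qed.

Definition inner_dual x : dual V := Dual (inner_dual_subproof x).

Lemma dual_linear (g : dual V) : linear g.
Proof. by case: g => g /= ; rewrite inE /= => -[]. Qed.

Lemma dual_continuous (g : dual V) : continuous g.
Proof. by case: g => g /= ; rewrite inE /= => -[]. Qed.

Lemma cvg_innerr {T} {F : set_system T} {FF : Filter F} (u : T -> V) x y :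
  u @ F --> x -> inner y (u t) @[t --> F] --> inner y x.
Proof.
by move=> ux; exact: (cvg_comp _ _ ux (@dual_continuous (inner_dual y) x)).
Qed.

Lemma dualD (g : dual V) x y : g (x + y) = g x + g y.
Proof. by have := dual_linear g 1 x y; rewrite !scale1r. Qed.

Lemma dual0 (g : dual V) : g 0 = 0.
Proof. by apply: (addrI (g 0)); rewrite -dualD !addr0. Qed.

Lemma dualZ (g : dual V) a x : g (a *: x) = a * g x.
Proof. by have := dual_linear g a x 0; rewrite dual0 !addr0. Qed.

Lemma dualN (g : dual V) x : g (- x) = - g x.
Proof. by rewrite -scaleN1r dualZ mulN1r. Qed.

Lemma dualB (g : dual V) x y : g (x - y) = g x - g y.
Proof. by rewrite dualD dualN. Qed.

Lemma dual_subE (g h : dual V) x : (g - h) x = g x - h x.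
Proof. by []. Qed.

Lemma dual_scaleE (g : dual V) a x : (a *: g) x = a * g x.
Proof. by []. Qed.

Definition convexS (C : set V) := forall t x y, 0 <= t <= 1 -> C x -> C y ->
  C (t *: x + (1 - t) *: y).

Definition nearest (C : set V) x p :=
  C p /\ forall q, C q -> `|x - p| <= `|x - q|.

(** A minimising sequence is Cauchy: the midpoint of two of its terms stays in [C], hence at
    distance at least [d] from [x]. *)
Lemma nearest_exists (C : set V) x :
  closed C -> convexS C -> C !=set0 -> exists p, nearest C x p.
Proof.
move=> Ccl Ccv [q0 Cq0].
pose D := [set `|x - q| | q in C].
have D0 : D !=set0 by exists `|x - q0|; exists q0.
have Dlb : has_lbound D by exists 0 => _ [q _ <-].
have D_inf : has_inf D by [].
pose d := inf D.
have dle q : C q -> d <= `|x - q| by move=> Cq; apply: ge_inf => //; exists q.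
have d0 : 0 <= d by apply: lb_le_inf => // _ [q _ <-].
have /choice[u uP] n : exists q, C q /\ `|x - q| <= d + n.+1%:R^-1.
  have e0 : 0 < n.+1%:R^-1 :> R by [].
  by have [_ [q Cq <-] /ltW qd] := inf_adherent e0 D_inf; exists q.
(* By the parallelogram identity, |u_n - u_m|^2 = 2 |x - u_n|^2 + 2 |x - u_m|^2 - 4 |x - mid|^2, and
   for n <= m both distances are at most d + 1/(n+1). *)
pose a n : R := 4 * (d + n.+1%:R^-1) ^+ 2 - 4 * d ^+ 2.
have dn : (d + n.+1%:R^-1) @[n --> \oo] --> d.
  rewrite -[X in _ --> X]addr0; apply: cvgD; first exact: cvg_cst.
  exact: cvg_harmonic.
have a0 : a @ \oo --> (0 : R).
  rewrite [X in _ --> X](_ : _ = 4 * (d * d) - 4 * (d * d)); last by ring.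
  apply: cvgB; last exact: cvg_cst.
  by apply: cvgMr; under eq_fun do rewrite expr2; exact: cvgM.
have ua n m : (n <= m)%N -> `|u n - u m| ^+ 2 <= a n.
  move=> nm; have [[Cn un] [Cm um]] := (uP n, uP m).
  have Cmid : C (2^-1 *: u n + (1 - 2^-1) *: u m)
    by apply: Ccv => //; apply/andP; split; lra.
  have := dle _ Cmid; set w := _ - _ => dw.
  have {dw} dw : d ^+ 2 <= inner w w by rewrite inner_norm ler_pXn2r// nnegrE.
  have mn : m.+1%:R^-1 <= n.+1%:R^-1 :> R by rewrite lef_pV2 ?posrE// ler_nat.
  have {}um : `|x - u m| <= d + n.+1%:R^-1 by rewrite (le_trans um)// lerD2l.
  have sq y : `|y| <= d + n.+1%:R^-1 -> inner y y <= (d + n.+1%:R^-1) ^+ 2.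
    move=> yd; rewrite inner_norm ler_pXn2r// nnegrE//.
    exact: le_trans yd.
  have {sq} := (sq _ un, sq _ um).
  rewrite -inner_norm /a; move: dw; rewrite /w !innerE.
  rewrite (innerC (u n) x) (innerC (u m) x) (innerC (u m) (u n)).
  by move: (n.+1%:R^-1) => e h1 [h2 h3]; lra.
have /cvg_ex[/= p up] := cvgn_of_sqr_dist_le a0 ua.
exists p; split.
  by apply: (closed_cvg C Ccl _ p up); apply: nearW => n; have [] := uP n.
move=> q Cq; apply: le_trans (dle _ Cq).
have xup : `|x - u n| @[n --> \oo] --> `|x - p|.
  by apply: cvg_norm; apply: cvgB => //; exact: cvg_cst.
by apply: (ler_cvg_to xup dn); apply: nearW => n; case: (uP n).
Qed.

(** Moving from [p] towards [q] by a fraction [t] cannot decrease the distance to [x]; expanding the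
    square gives 2 t b <= t^2 s. *)
Lemma nearest_inner (C : set V) x p :
  convexS C -> nearest C x p -> forall q, C q -> inner (x - p) (q - p) <= 0.
Proof.
move=> Ccv [Cp pmin] q Cq.
set b := inner (x - p) (q - p); set s := inner (q - p) (q - p).
have s0 : 0 <= s by rewrite /s inner_norm sqr_ge0.
have tb t : 0 <= t <= 1 -> 2 * t * b <= t ^+ 2 * s.
  move=> t01; have := pmin _ (Ccv t q p t01 Cq Cp).
  have -> : x - (t *: q + (1 - t) *: p) = (x - p) - t *: (q - p).
    rewrite scalerBl scale1r scalerBr !opprD !opprK !addrA.
    by rewrite -(addrA (x - _)) -(addrA x) [(- (t *: q)) + _]addrC !addrA.
  move=> h; have {h} : `|x - p| ^+ 2 <= `|x - p - t *: (q - p)| ^+ 2.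
    by rewrite ler_pXn2r// nnegrE.
  rewrite -!inner_norm /b /s; move: (x - p) (q - p) => e g.
  by rewrite !innerE (innerC g e) => h; lra.
rewrite leNgt; apply/negP => b0.
have bs : 0 < b + s by rewrite ltr_pwDl.
(* If b > 0, this t lies in [0, 1] even when s = 0, and t^2 s - 2 t b = - t^2 (2 b + s) < 0. *)
have := tb (b / (b + s)); rewrite divr_ge0 ?(ltW b0) ?(ltW bs)//=.
rewrite ler_pdivrMr// mul1r lerDl => /(_ s0).
rewrite -subr_ge0 (_ : _ - _ = - (b / (b + s)) ^+ 2 * (2 * b + s)); last first.
  by field; rewrite gt_eqF.
have : 0 < (b / (b + s)) ^+ 2 * (2 * b + s).
  by rewrite mulr_gt0 ?exprn_gt0 ?divr_gt0//; lra.
lra.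
Qed.

(** For nonzero [g], the difference [e] between a point outside the kernel and its projection is
    orthogonal to the kernel, which contains x - (g x / g e) e for every x. *)
Lemma riesz (g : dual V) : exists w, forall x, g x = inner w x.
Proof.
have [g0|] := pselect (forall x, g x = 0).
  by exists 0 => x; rewrite g0 inner0l.
move=> /existsNP[x0 gx0].
pose N := [set x | g x = 0 :> R].
have Ncl : closed N.
  apply: (@preimage_closed _ _ g [set (0 : R)]); last exact: closed_eq.
  by move=> x _; exact: dual_continuous.
have Ncv : convexS N.
  by move=> t x y _; rewrite /N/= => gx gy; rewrite dualD !dualZ gx gy; lra.
have N0 : N !=set0 by exists 0; exact: dual0.
have [p /[dup] -[Np _] /(nearest_inner Ncv) pN] := nearest_exists x0 Ncl Ncv N0.
pose e := x0 - p.
have ge : g e = g x0 by rewrite dualB Np subr0.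
have e_orth x : N x -> inner e x = 0.
  move=> Nx; have h y : N y -> inner e y <= 0.
    move=> Ny; have := pN (y + p); rewrite addrK; apply.
    by rewrite /N/= dualD Ny Np addr0.
  apply/eqP; rewrite eq_le h//= -oppr_le0 -innerNr h//.
  by rewrite /N/= dualN Nx oppr0.
have ge0 : g e != 0 by rewrite ge; apply/eqP.
have ee0 : inner e e != 0.
  rewrite inner_norm expf_eq0/= normr_eq0; apply/eqP => e0.
  by move: ge0; rewrite e0 dual0 eqxx.
exists ((g e / inner e e) *: e) => x.
have := e_orth (x - (g x / g e) *: e).
rewrite innerBr innerZr innerZl => h.
have {h}-> : inner e x = g x / g e * inner e e.
  by apply/eqP; rewrite -subr_eq0 h//= /N/= dualB dualZ divfK ?subrr.
by field; apply/andP.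
Qed.

End HilbertSpace.

(** * Variational inequalities for Lipschitz, strongly monotone operators *)

Section VariationalInequality.
Context {R : realType} {V : hilbertType R}.
Implicit Types (x y z : V) (C : set V) (f g : dual V).

(** The supremum in [dual_norm] is taken in the reals, so the set must be shown bounded above; the
    Riesz representative provides the bound. *)
Lemma dual_norm_ge g x : `|g x| <= dual_norm g * `|x|.
Proof.
have [w gw] := riesz g.
have [->|x0] := eqVneq x 0; first by rewrite dual0 !normr0 mulr0.
have nx : 0 < `|x| by rewrite normr_gt0.
rewrite -ler_pdivrMr//.
have -> : `|g x| / `|x| = `|g (`|x|^-1 *: x)|.
  by rewrite dualZ normrM normfV normr_id mulrC.
apply: sup_upper_bound.
  split; first by exists `|g 0|, 0; rewrite //= normr0.
  exists `|w| => _ /= [v v1 <-]; rewrite gw.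
  by apply: le_trans (cauchy_schwarz _ _) _; rewrite ler_piMr.
by exists (`|x|^-1 *: x) => //=; rewrite normrZ normfV normr_id mulVf ?gt_eqF.
Qed.

Lemma dual_bounded g : exists2 k, 0 <= k & forall x, `|g x| <= k * `|x|.
Proof.
have [w gw] := riesz g.
by exists `|w| => // x; rewrite gw; exact: cauchy_schwarz.
Qed.

(** Adding the two obtuse-angle inequalities gives |p - q|^2 <= (x - y, p - q). *)
Lemma nearest_nonexpansive C x y p q :
  convexS C -> nearest C x p -> nearest C y q -> `|p - q| <= `|x - y|.
Proof.
move=> Ccv px qy.
have := nearest_inner Ccv px qy.1; have := nearest_inner Ccv qy px.1.
have [->|pq] := eqVneq p q; first by rewrite subrr normr0.
move=> h1 h2.
have npq : 0 < `|p - q| by rewrite normr_gt0 subr_eq0.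
rewrite -(ler_pM2r npq) -expr2 -inner_norm.
apply: le_trans (inner_le _ _).
move: h1 h2; rewrite !innerE (innerC q p).
by lra.
Qed.

(** Lions-Stampacchia: with [B u] the Riesz representative of A u - f and [P] the projection onto
    [C], solutions are the fixed points of u |-> P (u - rho B u), a contraction for suitable rho. *)
Lemma VI_exists (A : V -> dual V) f C :
  lipschitz_op A -> strongly_monotone A ->
  closed C -> convexS C -> C !=set0 ->
  exists2 y, C y & forall v, C v -> 0 <= (A y - f) (v - y).
Proof.
move=> [L0 lipA] [c0 c0_gt0 monA] Ccl Ccv C0.
have /choice[r rP] g := riesz g.
pose B u := r (A u - f).
have BE u v w : inner (B u - B v) w = (A u - A v) w.
  rewrite innerBl -!rP !dual_subE; lra.
(* The given Lipschitz constant carries no sign; the maximum is positive and at least [c0], which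
   makes [q2] nonnegative. *)
pose L := Num.max L0 c0.
have L_gt0 : 0 < L by rewrite lt_max c0_gt0 orbT.
have cL : c0 <= L by rewrite le_max lexx orbT.
have lipB u v : `|B u - B v| <= L * `|u - v|.
  have [->|Buv] := eqVneq (B u - B v) 0; first by rewrite normr0 mulr_ge0// ltW.
  have n0 : 0 < `|B u - B v| by rewrite normr_gt0.
  rewrite -(ler_pM2r n0) -expr2 -inner_norm BE.
  apply: le_trans (ler_norm _) _; apply: le_trans (dual_norm_ge _ _) _.
  rewrite ler_wpM2r//; apply: le_trans (lipA _ _) _.
  by rewrite ler_wpM2r// le_max lexx.
have /choice[P PP] x := nearest_exists x Ccl Ccv C0.
(* This value minimises 1 - 2 rho c0 + rho^2 L^2, the bound on the squared contraction factor; the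
   minimum is [q2]. *)
pose rho := c0 / L ^+ 2.
have L2 : 0 < L ^+ 2 by rewrite exprn_gt0.
pose T u := P (u - rho *: B u).
pose q2 := 1 - c0 ^+ 2 / L ^+ 2.
have q20 : 0 <= q2.
  by rewrite subr_ge0 ler_pdivrMr// mul1r ler_pXn2r// nnegrE ltW.
have q21 : q2 < 1 by rewrite gtrBl divr_gt0// exprn_gt0.
have Tlip u v : `|T u - T v| <= Num.sqrt q2 * `|u - v|.
  apply: le_trans (nearest_nonexpansive Ccv (PP _) (PP _)) _.
  rewrite -(@ler_pXn2r _ 2)// ?nnegrE ?mulr_ge0 ?sqrtr_ge0//.
  rewrite exprMn sqr_sqrtr// -[leLHS]inner_norm.
  have -> : u - rho *: B u - (v - rho *: B v) = (u - v) - rho *: (B u - B v).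
    rewrite scalerBr !opprB addrACA [RHS]addrACA; congr (_ + _).
    exact: addrC.
  have h1 : inner (B u - B v) (B u - B v) <= L ^+ 2 * `|u - v| ^+ 2.
    by rewrite inner_norm -exprMn ler_pXn2r ?nnegrE ?mulr_ge0// ltW.
  have h2 : c0 * `|u - v| ^+ 2 <= inner (B u - B v) (u - v).
    by rewrite BE; exact: monA.
  have rho0 : 0 < rho by rewrite divr_gt0.
  have {}h1 : rho ^+ 2 * inner (B u - B v) (B u - B v) <=
      rho ^+ 2 * (L ^+ 2 * `|u - v| ^+ 2) by rewrite ler_pM2l ?exprn_gt0.
  have {}h2 : rho * (c0 * `|u - v| ^+ 2) <= rho * inner (B u - B v) (u - v).
    by rewrite ler_pM2l.
  move: h1 h2; rewrite -inner_norm.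
  move: (B u - B v) (u - v) => b d h1 h2.
  have -> : q2 * inner d d = inner d d - 2 * (rho * (c0 * inner d d)) +
      rho ^+ 2 * (L ^+ 2 * inner d d).
    by rewrite /q2 /rho; field; rewrite gt_eqF.
  by rewrite !innerE (innerC d b); lra.
have TC : set_fun C C T by move=> x _ /=; exact: (PP _).1.
pose Tf : {fun C >-> C} := HB.pack T (isFun.Build _ _ _ _ _ TC).
have Tctr : is_contraction Tf.
  exists (NngNum (sqrtr_ge0 q2)); split => /=.
    by rewrite -[ltRHS]sqrtr1 ltr_sqrt.
  by move=> [u v] _ /=; exact: Tlip.
have [y Cy yT] := banach_fixed_point Tctr Ccl C0.
exists y => // v Cv.
have := nearest_inner Ccv (PP (y - rho *: B y)) Cv.
rewrite -[P _]/(Tf y) -yT addrAC subrr add0r innerNl innerZl -rP.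
rewrite oppr_le0 pmulr_rge0// divr_gt0//.
Qed.

Lemma VI_unique (A : V -> dual V) f C y z :
  strongly_monotone A ->
  C y -> (forall v, C v -> 0 <= (A y - f) (v - y)) ->
  C z -> (forall v, C v -> 0 <= (A z - f) (v - z)) -> y = z.
Proof.
move=> [c c0 monA] Cy yP Cz zP.
have := monA y z; have := yP _ Cz; have := zP _ Cy.
rewrite !dual_subE !dualB => h1 h2 h3.
have : c * `|y - z| ^+ 2 <= 0 by lra.
rewrite pmulr_rle0// => n0; apply/eqP.
by rewrite -subr_eq0 -normr_eq0 -sqrf_eq0 eq_le n0 sqr_ge0.
Qed.

End VariationalInequality.

(** * The order defined by a self-dual cone *)

Section SelfDualCone.
Context {R : realType} {H : hilbertType R} {K : set H}.
Context (Kcone : closed_convex_cone K) (Kdual : self_dual K).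
Implicit Types x y z : H.

Lemma self_dualP x : (forall y, K y -> 0 <= inner x y) -> K x.
Proof. by move=> xK; rewrite Kdual. Qed.

Lemma cone_inner_ge0 x y : K x -> K y -> 0 <= inner x y.
Proof. by rewrite {1}Kdual => /(_ y); exact. Qed.

Lemma cone0 : K 0.
Proof. by apply: self_dualP => y _; rewrite inner0l. Qed.

Lemma coneD x y : K x -> K y -> K (x + y).
Proof. by move=> Kx Ky; have := Kcone.2 1 1 x y; rewrite !scale1r; apply. Qed.

Lemma coneZ a x : 0 <= a -> K x -> K (a *: x).
Proof.
by move=> a0 Kx; have := Kcone.2 a 0 x x; rewrite scale0r addr0; apply.
Qed.

Lemma cone_convex : convexS K.
Proof.
by move=> t x y /andP[t0 t1] Kx Ky; apply: Kcone.2; rewrite ?subr_ge0.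
Qed.

Lemma leK_refl x : leK K x x.
Proof. by rewrite /leK subrr; exact: cone0. Qed.

Lemma leK_trans y x z : leK K x y -> leK K y z -> leK K x z.
Proof.
by move=> xy yz; rewrite /leK -(subrK y z) -addrA; exact: coneD.
Qed.

Lemma leK0 x : leK K 0 x <-> K x.
Proof. by rewrite /leK subr0. Qed.

Lemma leKZ a x y : 0 <= a -> leK K x y -> leK K (a *: x) (a *: y).
Proof. by move=> a0 xy; rewrite /leK -scalerBr; exact: coneZ. Qed.

Lemma leK_scale_le1 a x : a <= 1 -> K x -> leK K (a *: x) x.
Proof.
move=> a1 Kx; rewrite /leK -[x in x - _]scale1r -scalerBl.
by apply: coneZ => //; rewrite subr_ge0.
Qed.

Lemma leK_cvg (u v : nat -> H) x y : u @ \oo --> x -> v @ \oo --> y ->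
  (forall n, leK K (u n) (v n)) -> leK K x y.
Proof.
move=> ux vy uv.
apply: (closed_cvg K Kcone.1 _ _ (cvgB vy ux)); exact: nearW.
Qed.

(** Elements of the cone have nonnegative inner products, so |x|^2 <= (x, y) <= |y|^2. *)
Lemma leK_norm x y : K x -> leK K x y -> `|x| <= `|y|.
Proof.
move=> Kx xy; rewrite -(@ler_pXn2r _ 2)// ?nnegrE// -!inner_norm.
have Ky : K y by apply/leK0; apply: leK_trans xy; apply/leK0.
have := cone_inner_ge0 Kx xy; have := cone_inner_ge0 Ky xy.
by rewrite !innerBr (innerC y x); lra.
Qed.

Lemma pos_nearest x : nearest K x (pos K x).
Proof.
apply: xgetPex; apply: nearest_exists; [exact: Kcone.1|exact: cone_convex|].
by exists 0; exact: cone0.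
Qed.

Lemma pos_cone x : K (pos K x).
Proof. exact: (pos_nearest x).1. Qed.

Lemma pos_ge x : leK K x (pos K x).
Proof.
apply: self_dualP => y Ky.
(* The obtuse-angle inequality at the cone point pos x + y reads (x - pos x, y) <= 0. *)
have := nearest_inner cone_convex (pos_nearest x) (coneD (pos_cone x) Ky).
by rewrite addrAC subrr add0r -opprB innerNl oppr_le0.
Qed.

Lemma pos_id x : K x -> pos K x = x.
Proof.
move=> Kx; have := (pos_nearest x).2 _ Kx; rewrite subrr normr0 normr_le0.
by rewrite subr_eq0 => /eqP.
Qed.

Lemma nonincreasing_leK (u : nat -> H) : (forall n, leK K (u n.+1) (u n)) ->
  forall n m, (n <= m)%N -> leK K (u m) (u n).
Proof.
move=> dec n m /subnK <-; elim: (m - n)%N => [|k ih]; first exact: leK_refl.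
exact: leK_trans (dec _) ih.
Qed.

(* For 0 <= x <= y in a self-dual cone, |y - x|^2 <= |y|^2 - |x|^2. *)
Lemma nonincreasing_cone_cvgn (u : nat -> H) : (forall n, K (u n)) ->
  (forall n, leK K (u n.+1) (u n)) -> cvgn u.
Proof.
move=> Ku dec; have dec' := nonincreasing_leK dec.
pose a n : R := `|u n| ^+ 2.
have anoninc : nonincreasing_seq a.
  move=> n m nm; rewrite ler_pXn2r ?nnegrE//.
  by apply: leK_norm => //; exact: dec'.
have alb : has_lbound (range a) by exists 0 => _ [n _ <-]; exact: sqr_ge0.
have acvg := nonincreasing_cvgn anoninc alb.
apply: (@cvgn_of_sqr_dist_le _ _ _ (fun n => a n - inf (range a))).
  by rewrite -(subrr (inf (range a))); apply: cvgB => //; exact: cvg_cst.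
move=> n m nm; apply: (@le_trans _ _ (a n - a m)).
  rewrite /a -!inner_norm.
  have := cone_inner_ge0 (Ku m) (dec' _ _ nm).
  by rewrite !innerE (innerC (u n) (u m)); lra.
by rewrite lerD2l lerN2; apply: ge_inf => //; exists m.
Qed.

End SelfDualCone.

(** * Weak limits in V of bounded sequences converging in H *)

Section WeakLimit.
Context {R : realType} {V H : hilbertType R} (j : gelfand V H).

(* The functionals along which u converges form a closed subspace; it contains
   the image of H, which is dense because j is injective. *)
Lemma weak_cvg_of_bounded (u : nat -> V) (h : H) (B : R) :
  (forall n, `|u n| <= B) -> (fun n => j (u n)) @ \oo --> h ->
  exists2 y, j y = h & weak_cvg u y.
Proof.
move=> uB uh.
pose D := [set w : V | cvgn (fun n => inner w (u n) : R)].
have D_lin a b x y : D x -> D y -> D (a *: x + b *: y).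
  move=> /cvg_ex[/= l xl] /cvg_ex[/= m ym]; apply/cvg_ex.
  exists (a * l + b * m).
  under eq_fun do rewrite innerDl !innerZl.
  by apply: cvgD; apply: cvgMr.
have D0 : D 0.
  by apply/cvg_ex; exists 0; under eq_fun do rewrite inner0l; exact: cvg_cst.
have B0 : 0 <= B by exact: le_trans (uB 0%N).
have Dcl : closed D.
  move=> w Dw; apply/cauchy_cvgP/cauchy_exP => e e0.
  (* [B + 1] replaces [B], which may be zero. *)
  have d0 : 0 < e / 3 / (B + 1) by rewrite !divr_gt0//; lra.
  have [w' [Dw' /= ww']] := Dw _ (nbhsx_ballx w _ d0).
  move: ww'; rewrite -ball_normE /= => ww'.
  have close n : `|inner w (u n) - inner w' (u n)| < e / 3.
    rewrite -innerBl (le_lt_trans (cauchy_schwarz _ _))//.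
    apply: (@le_lt_trans _ _ (`|w - w'| * (B + 1))).
      by rewrite ler_wpM2l// (le_trans (uB n))// lerDl.
    by rewrite -ltr_pdivlMr//; lra.
  have /cvg_ex[/= l w'l] := Dw'.
  have e3 : 0 < e / 3 by lra.
  exists l; have /cvgrPdist_lt/(_ _ e3) := w'l; apply: filterS => n /= ln.
  rewrite -ball_normE /=.
  have := close n; rewrite distrC => cn.
  rewrite -(subrK (inner w' (u n)) l) -addrA.
  apply: le_lt_trans (ler_normD _ _) _; lra.
(* The residual w - p is orthogonal to [D], which contains the representative [r] of the functional
   v |-> (j (w - p), j v). Hence |j (w - p)|^2 = (r, w - p) = 0. *)
have DV w : D w.
  have Dcv : convexS D by move=> t x y _; exact: D_lin.
  have [p pw] := nearest_exists w Dcl Dcv (ex_intro _ 0 D0).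
  have orth q : D q -> inner (w - p) q = 0.
    have le0 q' : D q' -> inner (w - p) q' <= 0.
      move=> Dq'; have := nearest_inner Dcv pw (D_lin 1 1 _ _ pw.1 Dq').
      by rewrite !scale1r addrAC subrr add0r.
    move=> Dq; apply/eqP; rewrite eq_le le0//= -oppr_le0 -innerNr le0//.
    by have := D_lin (-1) 0 _ _ Dq Dq; rewrite scaleN1r scale0r addr0.
  suff -> : w = p by exact: pw.1.
  apply/subr0_eq/(@gemb_inj _ _ _ j); rewrite linear0.
  have [r rP] := riesz (pivot j (j (w - p))).
  apply/eqP; rewrite -normr_eq0 -sqrf_eq0 -inner_norm.
  have -> : inner (j (w - p)) (j (w - p)) = inner r (w - p) by rewrite -rP.
  rewrite innerC orth//; apply/cvg_ex; exists (inner (j (w - p)) h).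
  under eq_fun do rewrite -rP.
  exact: cvg_innerr.
(* The pointwise limit is a linear functional bounded by [B]; its Riesz representative is the weak
   limit. *)
pose l (w : V) : R := limn (fun n => inner w (u n) : R).
have lP w : (fun n => inner w (u n) : R) @ \oo --> l w by exact: DV.
have l_lin : linear (l : V -> R^o).
  move=> a x y; change (l (a *: x + y) = a * l x + l y).
  apply: cvg_lim => //; under eq_fun do rewrite innerDl innerZl.
  apply: cvgD; last exact: lP. apply: (@cvgMr _ _ _ _ _ a); exact: lP.
have l_bd w : `|l w| <= B * `|w|.
  have lw : `|inner w (u n)| @[n --> \oo] --> `|l w|.
    by apply: cvg_norm; exact: lP.
  apply: (cvgr_to_le lw).
  apply: nearW => n; rewrite mulrC (le_trans (cauchy_schwarz _ _))//.
  by rewrite ler_wpM2l.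
have l_cont : continuous (l : V -> R^o).
  pose L := GRing.isLinear.Build R V R^o *:%R _ l_lin.
  pose ll : {linear V -> R^o} := HB.pack (l : V -> R^o) L.
  apply: (@bounded_linear_continuous _ _ _ ll).
  apply/linear_boundedP; near=> r => x.
  apply: le_trans (l_bd x) _.
  by rewrite ler_wpM2r//; near: r; exact: nbhs_pinfty_ge.
have l_dual : (l : V -> R^o) \in @dual_pred R V by rewrite inE.
have [y yP] := riesz (Dual l_dual).
have ly w : l w = inner w y by rewrite innerC -yP.
have wk : weak_cvg u y.
  move=> g; have [w gw] := riesz g.
  by rewrite gw -ly; under eq_fun do rewrite gw; exact: lP.
exists y => //.
(* Paired with j y - h, the sequence j (u n) tends both to (j y - h, j y), by weak convergence, and
   to (j y - h, h). *)
apply/subr0_eq/eqP; rewrite -normr_eq0 -sqrf_eq0 -inner_norm innerBr subr_eq0.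
have yl : inner (j y - h) (j (u n)) @[n --> \oo] --> inner (j y - h) (j y).
  exact: (wk (pivot j (j y - h))).
apply/eqP; rewrite -(cvg_lim (@Rhausdorff R) yl).
by apply: cvg_lim => //; exact: cvg_innerr.
Unshelve. all: by end_near. Qed.

End WeakLimit.

(** * Norm convergence from explicit bounds *)

Lemma cvg_of_sqr_dist_le (R : realType) (V : normedModType R)
    (u : nat -> V) (l : V) (a : nat -> R) :
  a @ \oo --> (0 : R) -> (forall n, `|u n - l| ^+ 2 <= a n) -> u @ \oo --> l.
Proof.
move=> a0 ua; apply/cvgrPdist_lt => e e0.
have e20 : 0 < e ^+ 2 by rewrite exprn_gt0.
near=> n; have an : a n < e ^+ 2 by near: n; exact: cvgr_lt a0 _ e20.
rewrite distrC -(@ltr_pXn2r _ 2)// ?nnegrE ?(ltW e0)//.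
exact: le_lt_trans an.
Unshelve. all: by end_near. Qed.

Lemma cvg_of_dist_le (R : realType) (V : normedModType R)
    (u : nat -> V) (l : V) (a : nat -> R) :
  a @ \oo --> (0 : R) -> (forall n, `|u n - l| <= a n) -> u @ \oo --> l.
Proof.
move=> a0 ua; apply/cvgrPdist_le => e e0; near=> n.
by rewrite distrC (le_trans (ua n))//; near: n; exact: cvgr_le a0 _ e0.
Unshelve. all: by end_near. Qed.

Lemma lipschitz_op_cvg (R : realType) (V : hilbertType R) (A : V -> dual V)
    (u w : nat -> V) (u0 w0 : V) :
  lipschitz_op A -> u @ \oo --> u0 -> w @ \oo --> w0 ->
  A (u n) (w n) @[n --> \oo] --> A u0 w0.
Proof.
move=> [L lipA] uu ww.
have -> : (fun n => A (u n) (w n)) =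
    (fun n => (A (u n) - A u0) (w n) + A u0 (w n)).
  by apply/funext => n; rewrite dual_subE subrK.
rewrite -[X in _ --> X]add0r; apply: cvgD; last first.
  exact: (cvg_comp _ _ ww (@dual_continuous _ _ (A u0) w0)).
have b0 : L * `|u n - u0| * `|w n| @[n --> \oo] --> (0 : R).
  rewrite -(mul0r `|w0|) -(mulr0 L); apply: cvgM; last exact: cvg_norm.
  apply: cvgMr; rewrite -(@normr0 _ V); apply: cvg_norm.
  by rewrite -(subrr u0); apply: cvgB => //; exact: cvg_cst.
have Ab n : `|(A (u n) - A u0) (w n)| <= L * `|u n - u0| * `|w n|.
  by apply: le_trans (dual_norm_ge _ _) _; rewrite ler_wpM2r.
by apply: (cvg_of_dist_le b0) => n; rewrite subr0.
Qed.

(** * Essentially bounded functions *)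

Section EssentiallyBounded.
Context {R : realType} {N : nat} {Omega : set 'rV[R]_N.+1}.

Lemma Linfty_norm_ae (z : Linfty Omega) :
  \forall t \ae lebesgue_on Omega, `|z t| <= Linfty_norm z.
Proof.
have zfin : ('N[lebesgue_on Omega]_+oo [EFin \o z] < +oo)%E.
  exact: (@Lfunction_finite _ _ _ _ _ _ z).
rewrite /Linfty_norm; have := Lnorm_ge0 (lebesgue_on Omega) +oo%E (EFin \o z).
move: zfin; rewrite unlock /=; case: ifPn => [_ zfin z0|muT0 _ _].
  have : (ess_sup (lebesgue_on Omega) (abse \o (EFin \o z)) \is a fin_num)%E.
    by rewrite ge0_fin_numE.
  move=> /fineK zE; have := ess_sup_ge (lebesgue_on Omega) (abse \o (EFin \o z)).
  by apply: filterS => t /=; rewrite -[in X in X -> _]zE lee_fin.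
(* The norm is an essential supremum only on a space of positive measure; on a null space every
   property holds almost everywhere. *)
have muT : lebesgue_on Omega setT = 0%E.
  by apply/eqP; rewrite eq_le measure_ge0 andbT leNgt.
by exists setT; split.
Qed.

Lemma Linfty_norm_ge0 (z : Linfty Omega) : 0 <= Linfty_norm z.
Proof. exact/fine_ge0/Lnorm_ge0. Qed.

Context {H : hilbertType R} {K : set H} (fs : function_space Omega K).

(** With e the norm of f - g, almost everywhere nu g <= nu f + nu e <= nu f + e f, because nu <=
    f. *)
Lemma Linfty_scaled_le (nu : R) (f g : Linfty Omega) :
  0 < nu -> Linfty_ge nu f ->
  leK K ((nu / (nu + Linfty_norm (f - g))) *: ofLinfty fs g) (ofLinfty fs f).
Proof.
move=> nu0 fnu; set e := Linfty_norm _; set a := nu / _.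
rewrite /leK -linearZ -linearB; apply/ofLinfty_order.
have := Linfty_norm_ae (f - g); rewrite -/e.
apply: filterS2 fnu => t /= ft.
change (`|f t - g t| <= e -> 0 <= f t - a * g t) => fg.
have e0 : 0 <= e by exact: le_trans fg.
have nue : 0 < nu + e by rewrite ltr_wpDr.
have -> : f t - a * g t =
    ((f t - nu) * e + nu * (f t - g t + e)) / (nu + e).
  by rewrite /a; field; rewrite gt_eqF.
apply: divr_ge0; last exact: ltW.
rewrite addr_ge0// mulr_ge0//; first by rewrite subr_ge0.
  exact: ltW.
by move: fg; rewrite ler_norml => /andP[]; lra.
Qed.

Lemma Linfty_cvg_ofLinfty (z : nat -> Linfty Omega) (l : Linfty Omega) :
  Linfty_cvg z l -> ofLinfty fs (z n) @[n --> \oo] --> ofLinfty fs l.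
Proof.
move=> zl; have [C zC] := ofLinfty_bounded fs.
apply: (@cvg_of_dist_le _ _ _ _ (fun n => C * Linfty_norm (z n - l))).
  by rewrite -(mulr0 C); apply: cvgMr.
by move=> n; rewrite -linearB; exact: zC.
Qed.

End EssentiallyBounded.

(** * The obstacle problem: comparison, bounds and solvability *)

Section Obstacle.
Context {R : realType} {V H : hilbertType R} {j : gelfand V H} {K : set H}.
Context {A : V -> dual V}.
Context (Kcone : closed_convex_cone K) (Kdual : self_dual K)
  (Ksup : supK_lub K) (Kpos : pos_stable j K).
Context (A_hom : pos_homogeneous A) (A_lip : lipschitz_op A)
  (A_mono : strongly_monotone A) (A_T : T_monotone j K A).
Implicit Types (u v y z p : V) (psi : H) (f g F : dual V).

Let K0 : K 0 := cone0 Kdual.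
Let Ktrans := leK_trans Kcone.

Lemma posVE v : j (posV j K v) = pos K (j v).
Proof.
by apply: (@xgetPex _ (0 : V) [set w | j w = pos K (j v)]); exact: Kpos.1.
Qed.

Lemma posV_cone v : K (j (posV j K v)).
Proof. by rewrite posVE; exact: pos_cone. Qed.

(** Homogeneity is assumed for t > 0 only; t = 2 gives A 0 = 2 A 0. *)
Lemma homogeneous_op0 : A 0 = 0.
Proof.
have := A_hom 0 (ltr0Sn R 1); rewrite scaler0 => A0.
apply/eqP; rewrite -(inj_eq (addrI (A 0))) addr0 [X in _ == X]A0.
by rewrite scaler_nat mulr2n.
Qed.

(** T-monotonicity makes the pairing zero, and its equality case gives (u - v)^+ = 0. *)
Lemma op_comparison u v : (A u - A v) (posV j K (u - v)) <= 0 ->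
  leK K (j u) (j v).
Proof.
move=> le0; have [ge0 /iffLR pos0] := A_T u v.
have {}pos0 : posV j K (u - v) = 0 by apply: pos0; apply/eqP; rewrite eq_le le0.
have := pos_ge Kcone Kdual (j (u - v)); rewrite -posVE pos0 linear0.
by rewrite /leK sub0r linearB opprB.
Qed.

(** This class contains 0 and all solutions, and it survives scaling and increases of the data, so
    one comparison principle serves every later estimate. *)
Definition subsolution f psi z :=
  leK K (j z) psi /\ forall p, K (j p) -> (A z - f) p <= 0.

Lemma VI_subsolution f psi y : VI_solution j K A f psi y -> subsolution f psi y.
Proof.
move=> [ypsi yVI]; split=> // p Kp.
(* Lowering [y] keeps it below the obstacle. *)
have : obstacle_set j K psi (y - p).
  by apply: Ktrans ypsi; rewrite /leK linearB opprB addrC subrK.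
by move=> /yVI; rewrite addrAC subrr add0r dualN oppr_ge0.
Qed.

Lemma subsolution_mono f g psi phi z : dual_le j K f g -> leK K psi phi ->
  subsolution f psi z -> subsolution g phi z.
Proof.
move=> fg psiphi [zpsi zsub]; split; first exact: Ktrans psiphi.
by move=> p Kp; have := zsub _ Kp; have := fg _ Kp; rewrite !dual_subE; lra.
Qed.

(* Tests the variational inequality of y with sup (z, y). *)
Lemma subsolution_le f psi z y :
  subsolution f psi z -> VI_solution j K A f psi y -> leK K (j z) (j y).
Proof.
move=> [zpsi zsub] [ypsi yVI]; apply: op_comparison.
set p := posV _ _ _.
have Kp : K (j p) by exact: posV_cone.
have : obstacle_set j K psi (y + p).
  by rewrite /obstacle_set /= linearD posVE linearB; exact: Ksup.
move=> /yVI; rewrite addrAC subrr add0r; have := zsub _ Kp.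
by rewrite !dual_subE; lra.
Qed.

(** Here [y] solves no obstacle problem; with y = [ybar] this bounds all subsolutions with data
    below [F]. *)
Lemma subsolution_le_of_op_ge f psi z y :
  subsolution f psi z -> dual_le j K f (A y) -> leK K (j z) (j y).
Proof.
move=> [_ zsub] fAy; apply: op_comparison.
have Kp := posV_cone (z - y).
have := zsub _ Kp; have := fAy _ Kp.
by rewrite !dual_subE; lra.
Qed.

Lemma subsolution_scale f psi z a : 0 < a -> subsolution f psi z ->
  subsolution (a *: f) (a *: psi) (a *: z).
Proof.
move=> a0 [zpsi zsub]; split.
  by rewrite linearZ; apply: leKZ => //; exact: ltW.
move=> p /zsub; rewrite A_hom// -scalerBr dual_scaleE => le0.
by rewrite pmulr_rle0.
Qed.

(** Since A 0 = 0, strong monotonicity gives c |y|^2 <= A y y <= F y <= k |y|. The bound depends on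
    [F] alone, hence is uniform over data below [F]. *)
Lemma op_coercive_bound F :
  exists B, forall y, A y y <= F y -> `|y| <= B.
Proof.
have [c c0 monA] := A_mono; have [k k0 kF] := dual_bounded F.
exists (k / c) => y Ayy.
have [->|y0] := eqVneq y 0; first by rewrite normr0 divr_ge0// ltW.
have ny : 0 < `|y| by rewrite normr_gt0.
rewrite ler_pdivlMr// -(ler_pM2r ny).
have := monA y 0; rewrite homogeneous_op0 !subr0 => h.
have := kF y; have := ler_norm (F y).
by move: h; rewrite expr2; lra.
Qed.

Lemma VI_sol_test0 f psi y : K psi -> VI_solution j K A f psi y -> A y y <= f y.
Proof.
move=> Kpsi [_ yVI]; have := yVI 0; rewrite sub0r dualN dual_subE.
by rewrite /obstacle_set/= /leK linear0 subr0 => /(_ Kpsi); lra.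
Qed.

Lemma obstacle_set_closed psi : closed (obstacle_set j K psi).
Proof.
apply: (@preimage_closed _ _ (fun v => psi - j v) K); last exact: Kcone.1.
move=> v _; apply: cvgB; first exact: cvg_cst.
exact: gemb_continuous.
Qed.

Lemma obstacle_set_convex psi : convexS (obstacle_set j K psi).
Proof.
move=> t x y /andP[t0 t1]; rewrite /obstacle_set /leK /= => Kx Ky.
have := cone_convex Kcone (t := t) _ Kx Ky.
rewrite t0 t1 => /(_ isT); congr K.
rewrite [j (_ + _)]linearD ![j (_ *: _)]linearZ /= !scalerBr.
rewrite addrACA -opprD -scalerDl.
by rewrite [t + _]addrC subrK scale1r.
Qed.

Lemma VI_solP f psi : K psi -> VI_solution j K A f psi (VI_sol j K A f psi).
Proof.
move=> Kpsi; apply: xgetPex.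
have [|y Cy yVI] := VI_exists f A_lip A_mono (@obstacle_set_closed psi)
  (@obstacle_set_convex psi); last by exists y.
by exists 0; rewrite /obstacle_set /leK /= linear0 subr0.
Qed.

Lemma VI_sol_unique f psi y : VI_solution j K A f psi y ->
  VI_sol j K A f psi = y.
Proof.
move=> ysol; have [? ?] : VI_solution j K A f psi (VI_sol j K A f psi).
  by apply: xgetPex; exists y.
by case: ysol => ? ?; apply: (VI_unique A_mono (f := f)); eassumption.
Qed.

Lemma subsolution0 f psi : K psi -> dual_le j K 0 f -> subsolution f psi 0.
Proof.
move=> Kpsi f0; split; first by rewrite linear0; exact/leK0.
move=> p Kp; have := f0 _ Kp.
by rewrite homogeneous_op0 !dual_subE; lra.
Qed.

Lemma VI_sol_ge0 f psi y : K psi -> dual_le j K 0 f ->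
  VI_solution j K A f psi y -> K (j y).
Proof.
move=> Kpsi f0 ysol; apply/leK0; rewrite -[X in leK _ X](linear0 j).
exact: subsolution_le (subsolution0 Kpsi f0) ysol.
Qed.

(** Brings the alternatives of Assumption (A) to convergence of the obstacles in H, through the
    boundedness of [ofLinfty] or the continuity of [j]. *)
Lemma ext_map_cvg (N : nat) (Omega : set 'rV[R]_N.+1)
    (fs : function_space Omega K) nu (Phi : H -> H) (v : nat -> V) (v0 : V) :
  assumption_A_a j fs nu Phi \/ assumption_A_b j K Phi -> weak_cvg v v0 ->
  ext_map K Phi (j (v n)) @[n --> \oo] --> ext_map K Phi (j v0).
Proof.
case=> [hA /hA[]|[hA _] /hA//].
- move=> [z [z0 [zE z0E _ _ zz0]]]; rewrite -z0E; under eq_fun do rewrite -zE.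
  exact: Linfty_cvg_ofLinfty.
- move=> [w [w0 [wE w0E ww0]]]; rewrite -w0E; under eq_fun do rewrite -wE.
  exact: (cvg_comp _ _ ww0 (@gemb_continuous _ _ _ j w0)).
Qed.

(** * The quasi-variational inequality: the obstacle depends on the solution *)

Context {Phi : H -> H} {F : dual V} {ybar : V}.
Context (Phi_incr : increasing_map K Phi).
Context (Phi_cvg : forall (v : nat -> V) (v0 : V), weak_cvg v v0 ->
  ext_map K Phi (j (v n)) @[n --> \oo] --> ext_map K Phi (j v0)).
Context (F_ge0 : dual_le j K 0 F) (ybarE : A ybar = F).

Local Notation S f psi := (VI_sol j K A f psi).
Local Notation M f := (QVI_max j K A Phi ybar f).

Lemma ybar_ge0 : K (j ybar).
Proof.
apply/leK0; rewrite -[X in leK _ X](linear0 j).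
apply: (subsolution_le_of_op_ge (subsolution0 (f := 0) K0 _)).
  by move=> v _; rewrite subrr.
by rewrite ybarE.
Qed.

(* The largest fixed point is the limit of the decreasing iterates of
   [y |-> S f (Phi y)] started at [ybar]. *)
Lemma largest_fixed_point_exists f : dual_le j K 0 f -> dual_le j K f F ->
  exists y, QVI_fixed_points j K A Phi ybar f y /\
    forall z, K (j z) -> leK K (j z) (j ybar) ->
      subsolution f (Phi (j z)) z ->
      leK K (j z) (j y).
Proof.
move=> f0 fF; have [PhiK Phi_le] := Phi_incr.
have Ssol psi := VI_solP f (psi := psi).
pose u k := iter k (fun y => S f (Phi (j y))) ybar.
have uS k : u k.+1 = S f (Phi (j (u k))) by [].
have Ku k : K (j (u k)).
  elim: k => [|k ih]; first exact: ybar_ge0.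
  by rewrite uS; apply: (VI_sol_ge0 _ f0 (Ssol _ _)); exact: PhiK.
have usol k : VI_solution j K A f (Phi (j (u k))) (u k.+1).
  by rewrite uS; apply: Ssol; exact: PhiK.
have S_le_ybar psi y : VI_solution j K A f psi y -> leK K (j y) (j ybar).
  move=> /VI_subsolution/subsolution_le_of_op_ge; apply => //.
  by rewrite ybarE.
(* Every solution lies below [ybar], which starts the induction; then smaller iterates give smaller
   obstacles. *)
have udec k : leK K (j (u k.+1)) (j (u k)).
  elim: k => [|k ih]; first exact: S_le_ybar (usol 0%N).
  apply: subsolution_le (usol k).
  apply: subsolution_mono (VI_subsolution (usol k.+1)).
    by move=> p _; rewrite subrr.
  exact: Phi_le.
have [B Bbound] := op_coercive_bound F.
(* Indices start at 1 because [u 0], which is [ybar], does not come from an obstacle problem. *)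
have uB k : `|u k.+1| <= B.
  apply: Bbound; apply: le_trans (VI_sol_test0 _ (usol k)) _; first exact: PhiK.
  by rewrite -subr_ge0; exact: fF (Ku k.+1).
have /cvg_ex[h uh] := nonincreasing_cone_cvgn Kcone Kdual Ku udec.
have u1h : j (u k.+1) @[k --> \oo] --> h.
  by rewrite (cvg_shiftS (fun k => j (u k))).
have [y jy wk] := weak_cvg_of_bounded uB u1h.
have Ky : K (j y).
  by rewrite jy; apply: (closed_cvg K Kcone.1 _ _ uh); exact: nearW.
have y_le k : leK K (j y) (j (u k)).
  rewrite jy; have ucst : (fun _ : nat => j (u k)) @ \oo --> j (u k).
    exact: cvg_cst.
  have uhk : (fun n => j (u (n + k)%N)) @ \oo --> h.
    by rewrite (cvg_shiftn k (fun k => j (u k))).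
  apply: (leK_cvg Kcone uhk ucst) => n.
  by apply: (nonincreasing_leK Kcone Kdual udec); exact: leq_addl.
have psi_cvg : Phi (j (u k.+1)) @[k --> \oo] --> Phi (j y).
  have := Phi_cvg wk; rewrite /ext_map (pos_id Kcone Kdual Ky).
  by under eq_fun do rewrite (pos_id Kcone Kdual (Ku _)).
have psi_le k : leK K (Phi (j y)) (Phi (j (u k))) by exact: Phi_le.
have ypsi : obstacle_set j K (Phi (j y)) y.
  rewrite /obstacle_set /= {1}jy.
  have u2h : j (u k.+2) @[k --> \oo] --> h.
    by rewrite (cvg_shiftS (fun k => j (u k.+1))).
  by apply: (leK_cvg Kcone u2h psi_cvg) => k; exact: (usol k.+1).1.
have [c c0 monA] := A_mono.
(* Since y <= Phi y <= Phi (u k), [y] is admissible in the inequality of [u k.+1]; so c |u k.+1 -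
   y|^2 <= <f - A y, u k.+1 - y>, which vanishes by weak convergence. *)
have uy : u k.+1 @[k --> \oo] --> y.
  apply: (@cvg_of_sqr_dist_le _ _ _ _
    (fun k => c^-1 * ((f - A y) (u k.+1) - (f - A y) y))).
    rewrite -(mulr0 c^-1) -(subrr ((f - A y) y)); apply: cvgMr.
    by apply: cvgB; [exact: wk|exact: cvg_cst].
  move=> k; rewrite ler_pdivlMl//; apply: le_trans (monA _ _) _.
  have /(usol k).2 : obstacle_set j K (Phi (j (u k))) y.
    exact: Ktrans (psi_le k).
  by rewrite !dual_subE !dualB; lra.
(* As the obstacles decrease to Phi y, each v <= Phi y is admissible at every stage, and the
   inequalities pass to the limit. *)
have ysol : VI_solution j K A f (Phi (j y)) y.
  split=> // v vpsi.
  have Auv : (A (u k.+1)) (v - u k.+1) @[k --> \oo] --> A y (v - y).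
    by apply: lipschitz_op_cvg => //; apply: cvgB => //; exact: cvg_cst.
  have fuv : f (v - u k.+1) @[k --> \oo] --> f (v - y).
    rewrite dualB; under eq_fun do rewrite dualB.
    by apply: cvgB; [exact: cvg_cst|exact: wk].
  apply: (cvgr_to_ge (cvgB Auv fuv)); apply: nearW => k.
  by apply: (usol k).2; exact: Ktrans (psi_le k).
exists y; split.
  split; [exact/leK0|exact: y_le 0%N|exact: VI_sol_unique].
move=> z Kz zybar zsub.
have z_le k : leK K (j z) (j (u k)).
  elim: k => [//|k ih].
  apply: subsolution_le (usol k); apply: subsolution_mono zsub.
    by move=> p _; rewrite subrr.
  exact: Phi_le.
rewrite jy.
have zcst : (fun _ : nat => j z) @ \oo --> j z by exact: cvg_cst.
exact: (leK_cvg Kcone zcst uh).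
Qed.

(** Shows that the choice in [QVI_max] does not fall back on its default, and extends maximality
    from fixed points to subsolutions: these lie below the limit of the iterates, itself a fixed
    point. *)
Lemma QVI_maxP f : dual_le j K 0 f -> dual_le j K f F ->
  [/\ K (j (M f)), leK K (j (M f)) (j ybar),
      VI_solution j K A f (Phi (j (M f))) (M f) &
      forall z, K (j z) -> leK K (j z) (j ybar) ->
        subsolution f (Phi (j z)) z ->
        leK K (j z) (j (M f))].
Proof.
move=> f0 fF; have [PhiK _] := Phi_incr.
have fix_sub z : QVI_fixed_points j K A Phi ybar f z ->
    VI_solution j K A f (Phi (j z)) z.
  move=> [/leK0 Kz _ zE]; rewrite -{2}zE.
  by apply: VI_solP => //; exact: PhiK.
have [y [yfix ydom]] := largest_fixed_point_exists f0 fF.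
have [Mfix Mmax] : QVI_fixed_points j K A Phi ybar f (M f) /\
    forall z, QVI_fixed_points j K A Phi ybar f z -> leK K (j z) (j (M f)).
  apply: (@xgetPex _ (0 : V) [set y | QVI_fixed_points j K A Phi ybar f y /\
    forall z, QVI_fixed_points j K A Phi ybar f z -> leK K (j z) (j y)]).
  exists y; split=> // z zfix; apply: ydom.
  - by case: zfix => /leK0.
  - by case: zfix.
  - exact/VI_subsolution/fix_sub.
split; [by case: Mfix => /leK0|by case: Mfix|exact: fix_sub|].
move=> z Kz zybar zsub; apply: Ktrans (Mmax _ yfix); exact: ydom.
Qed.

End Obstacle.

(** * Monotone convergence of the largest fixed points *)

Theorem lemma5 (R : realType) (N : nat) (Omega : set 'rV[R]_N.+1)
    (V H : hilbertType R) (j : gelfand V H) (Hplus : set H)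
    (fs : function_space Omega Hplus)
    (A : V -> dual V) (Phi : H -> H) (nu : R) (F : dual V) (ybar : V)
    (f : nat -> Linfty Omega) (fstar : Linfty Omega)
    (Omega_open : open Omega)
    (Hplus_cone : closed_convex_cone Hplus)
    (Hplus_self_dual : self_dual Hplus)
    (Hplus_sup : supK_lub Hplus)
    (V_pos : pos_stable j Hplus)
    (A_homogeneous : pos_homogeneous A)
    (A_lipschitz : lipschitz_op A)
    (A_strongly_monotone : strongly_monotone A)
    (A_T_monotone : T_monotone j Hplus A)
    (nu_gt0 : 0 < nu)
    (F_ge0 : dual_le j Hplus 0 F)
    (ybarE : A ybar = F)
    (f_ge_nu : forall n, Linfty_ge nu (f n))
    (f_ge0 : forall n, dual_le j Hplus 0 (pivot j (ofLinfty fs (f n))))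
    (f_leF : forall n, dual_le j Hplus (pivot j (ofLinfty fs (f n))) F)
    (f_nondecreasing : forall n,
      leK Hplus (ofLinfty fs (f n)) (ofLinfty fs (f n.+1)))
    (f_cvg : Linfty_cvg f fstar)
    (Phi_increasing : increasing_map Hplus Phi)
    (Phi_scaling : forall (lambda : R) (y : H), 0 < lambda < 1 -> Hplus y ->
      leK Hplus (lambda *: Phi y) (Phi (lambda *: y)))
    (Phi_A : assumption_A_a j fs nu Phi \/ assumption_A_b j Hplus Phi) :
  let M (g : Linfty Omega) : V :=
    QVI_max j Hplus A Phi ybar (pivot j (ofLinfty fs g)) in
  cvg_up Hplus (fun n => j (M (f n))) (j (M fstar)) /\
  (fun n => M (f n)) @ \oo --> M fstar.
Proof.
move=> M; pose phi n := ofLinfty fs (f n); pose phi0 := ofLinfty fs fstar.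
pose u n := M (f n); pose y := M fstar.
pose Ktrans := leK_trans Hplus_cone.
have phi_cvg : phi n @[n --> \oo] --> phi0 by exact: Linfty_cvg_ofLinfty.
have pair_cvg v : pivot j (phi n) v @[n --> \oo] --> pivot j phi0 v.
  under eq_fun do rewrite /pivot /= innerC; rewrite /= innerC.
  exact: cvg_innerr.
have phi_mono n m : (n <= m)%N -> leK Hplus (phi n) (phi m).
  move=> /subnK <-; elim: (m - n)%N => [|k ih]; first exact: leK_refl.
  exact: Ktrans ih (f_nondecreasing _).
have phi_le n : leK Hplus (phi n) phi0.
  have cst_n : (fun _ : nat => phi n) @ \oo --> phi n by exact: cvg_cst.
  have shift_cvg : (fun k => phi (k + n)%N) @ \oo --> phi0.
    by rewrite (cvg_shiftn n phi).
  by apply: (leK_cvg Hplus_cone cst_n shift_cvg) => k; exact/phi_mono/leq_addl.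
have pivot_le g h : leK Hplus g h -> dual_le j Hplus (pivot j g) (pivot j h).
  move=> gh v Kv; rewrite dual_subE /= -innerBl.
  exact: (cone_inner_ge0 Hplus_self_dual).
have phi0_ge0 : dual_le j Hplus 0 (pivot j phi0).
  move=> v Kv; rewrite dual_subE subr0; apply: (cvgr_to_ge (pair_cvg v)).
  by apply: nearW => n; have := f_ge0 n _ Kv; rewrite dual_subE subr0.
have phi0_leF : dual_le j Hplus (pivot j phi0) F.
  move=> v Kv; rewrite dual_subE subr_ge0; apply: (cvgr_to_le (pair_cvg v)).
  by apply: nearW => n; have := f_leF n _ Kv; rewrite dual_subE subr_ge0.
have Phi_cvg := ext_map_cvg Phi_A.
have MP g := QVI_maxP Hplus_cone Hplus_self_dual Hplus_sup V_pos A_homogeneous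
  A_lipschitz A_strongly_monotone A_T_monotone Phi_increasing Phi_cvg F_ge0
  ybarE (f := g).
have [Ky y_ybar ysol ydom] := MP _ phi0_ge0 phi0_leF.
have Ku n : Hplus (j (u n)) by have [] := MP _ (f_ge0 n) (f_leF n).
have u_ybar n : leK Hplus (j (u n)) (j ybar).
  by have [] := MP _ (f_ge0 n) (f_leF n).
have usol n : VI_solution j Hplus A (pivot j (phi n)) (Phi (j (u n))) (u n).
  by have [] := MP _ (f_ge0 n) (f_leF n).
(* Taking h = [phi0] yields u_n <= y, and h = [phi n.+1] yields u_n <= u_(n+1). *)
have usub n h : leK Hplus (phi n) h ->
    subsolution (j := j) (K := Hplus) (A := A)
      (pivot j h) (Phi (j (u n))) (u n).
  move=> le_h; apply: (subsolution_mono Hplus_cone _ (leK_refl Hplus_self_dual _)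
    (VI_subsolution Hplus_cone (usol n))); exact: pivot_le.
have u_le_y n : leK Hplus (j (u n)) (j y) by exact: ydom (usub _ _ (phi_le n)).
have u_mono n : leK Hplus (j (u n)) (j (u n.+1)).
  have [_ _ _ udom] := MP _ (f_ge0 n.+1) (f_leF n.+1).
  exact: udom (usub _ _ (f_nondecreasing n)).
pose e n := Linfty_norm (f n - fstar); pose lam n := nu / (nu + e n).
have e_ge0 n : 0 <= e n by exact: Linfty_norm_ge0.
have nue n : 0 < nu + e n by rewrite ltr_wpDr.
have lam_gt0 n : 0 < lam n by exact: divr_gt0.
have lam_le1 n : lam n <= 1 by rewrite ler_pdivrMr// mul1r lerDl.
have lam_ge n : 1 - lam n <= e n / nu.
  have -> : 1 - lam n = e n / (nu + e n) by rewrite /lam; field; rewrite gt_eqF.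
  by rewrite ler_wpM2l// lef_pV2 ?posrE// lerDl.
(* lam y is a subsolution for lam phi0 <= phi_n and the obstacle lam Phi y <= Phi (lam y). *)
have lam_y_le n : leK Hplus (j (lam n *: y)) (j (u n)).
  have [_ _ _ udom] := MP _ (f_ge0 n) (f_leF n).
  have jlam : j (lam n *: y) = lam n *: j y by rewrite linearZ.
  have lamy : leK Hplus (lam n *: j y) (j y).
    exact: (leK_scale_le1 Hplus_cone).
  apply: udom; rewrite jlam.
  - exact: coneZ (ltW (lam_gt0 n)) Ky.
  - exact: Ktrans lamy y_ybar.
  - apply: (subsolution_mono Hplus_cone _ _ (subsolution_scale Hplus_cone
      A_homogeneous (lam_gt0 n) (VI_subsolution Hplus_cone ysol))).
      have := pivot_le _ _ (Linfty_scaled_le fs fstar nu_gt0 (f_ge_nu n)).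
      move=> le v /le; rewrite !dual_subE dual_scaleE /=.
      by rewrite innerZl.
    (* The scaling hypothesis excludes the factor 1, which occurs when [e n] is 0. *)
    have [lam1|lam1] := ltrP (lam n) 1.
      by apply: Phi_scaling; rewrite ?lam_gt0.
    have -> : lam n = 1 by apply/eqP; rewrite eq_le lam_le1.
    by rewrite !scale1r; exact: leK_refl.
have [B Bbound] := op_coercive_bound A_homogeneous A_strongly_monotone F.
have uB n : `|u n| <= B.
  apply: Bbound; apply: le_trans (VI_sol_test0 _ (usol n)) _.
    exact: Phi_increasing.1.
  by rewrite -subr_ge0; exact: f_leF.
have [c c0 monA] := A_strongly_monotone.
have [L lipA] := A_lipschitz.
have ju_dist n : `|j (u n - y)| <= `|j y|.
  rewrite linearB distrC; apply: (leK_norm Hplus_cone Hplus_self_dual).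
    exact: u_le_y.
  by rewrite /leK opprB addrC subrK.
have Auy n : `|A (u n) y| <= `|L| * B * `|y|.
  rewrite -[A (u n)]subr0 -(homogeneous_op0 A_homogeneous).
  apply: le_trans (dual_norm_ge _ _) _; rewrite ler_wpM2r//.
  apply: le_trans (lipA _ _) _; rewrite subr0.
  apply: (@le_trans _ _ (`|L| * `|u n|)); first by rewrite ler_wpM2r// ler_norm.
  by rewrite ler_wpM2l.
(* Adding both tests gives c |u_n - y|^2 <= <phi_n - phi0, u_n - y> + (1 - lam_n) <phi_n - A u_n,
   y>; the two terms of [a n] bound these, with 1 - lam_n <= e_n / nu. *)
pose a n := c^-1 * (`|phi n - phi0| * `|j y| +
  e n / nu * (`|L| * B * `|y| + `|pivot j (phi n) y|)).
have a0 : a n @[n --> \oo] --> (0 : R).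
  have phi_dist : `|phi n - phi0| @[n --> \oo] --> (0 : R).
    rewrite -(@normr0 _ H) -(subrr phi0); apply: cvg_norm.
    by apply: cvgB => //; exact: cvg_cst.
  rewrite /a -(mulr0 c^-1); apply: cvgMr; rewrite -[X in _ --> X]addr0.
  apply: cvgD; first by rewrite -(mul0r `|j y|); exact: cvgMl.
  rewrite -(mul0r (`|L| * B * `|y| + `|pivot j phi0 y|)); apply: cvgM.
    by rewrite -(mul0r nu^-1); exact: cvgMl.
  by apply: cvgD; [exact: cvg_cst|apply: cvg_norm; exact: pair_cvg].
have u_cvg : u @ \oo --> y.
  apply: (cvg_of_sqr_dist_le a0) => n; rewrite ler_pdivlMl//.
  apply: le_trans (monA _ _) _.
  (* [y] may exceed the obstacle of [u n], whereas lam y <= u_n <= Phi (u_n) is admissible. *)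
  have test1 : 0 <= (A (u n) - pivot j (phi n)) (lam n *: y - u n).
    by apply: (usol n).2; apply: Ktrans (lam_y_le n) (usol n).1.
  have test2 : 0 <= (A y - pivot j phi0) (u n - y).
    by apply: ysol.2; apply: Ktrans (u_le_y n) ysol.1.
  have pair_le : (pivot j (phi n) - pivot j phi0) (u n - y) <=
      `|phi n - phi0| * `|j y|.
    rewrite dual_subE /= -innerBl; apply: le_trans (inner_le _ _) _.
    by rewrite ler_wpM2l.
  have rem_le : (1 - lam n) * (pivot j (phi n) y - A (u n) y) <=
      e n / nu * (`|L| * B * `|y| + `|pivot j (phi n) y|).
    have h0 : 0 <= 1 - lam n by rewrite subr_ge0.
    apply: (@le_trans _ _ ((1 - lam n) *
      (`|L| * B * `|y| + `|pivot j (phi n) y|))).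
      rewrite ler_wpM2l//.
      have := ler_norm (pivot j (phi n) y); have := ler_norm (- A (u n) y).
      by rewrite normrN; have := Auy n; lra.
    rewrite ler_wpM2r//; apply: addr_ge0 => //; exact: le_trans (Auy n).
  move: test1 test2 pair_le rem_le.
  rewrite !dual_subE !dualB !dualZ.
  lra.
split=> //; split=> //.
exact: (cvg_comp _ _ u_cvg (@gemb_continuous _ _ _ j y)).
Qed.
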